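(* Let $W\in\mathbb{R}^{n\times n}$ be symmetric positive definite, let $T\in\mathbb{R}^{n\times n}$ be symmetric, indefinite and nonsingular, let $A=W+\mathrm{i}T$, and let $V\in\mathbb{R}^{n\times n}$ be symmetric positive definite. Let $\tilde\lambda_{\max}$ be the largest eigenvalue of $V^{-1}W$ and let $\tilde\mu_{\min}>0$ be the smallest absolute value of an eigenvalue of $V^{-1}T$. For $\alpha>0$ put $$G(V;\alpha)=\mathrm{i}\,T^{-1}W(\alpha V+W)^{-1}(\alpha V-\mathrm{i}T),\qquad \tilde\sigma(\alpha)=\frac{\tilde\lambda_{\max}}{\alpha+\tilde\lambda_{\max}}\cdot\frac{\sqrt{\alpha^{2}+\tilde\mu_{\min}^{2}}}{\tilde\mu_{\min}}.$$ Then $\rho(G(V;\alpha))\le\tilde\sigma(\alpha)$ for every $\alpha>0$. Moreover: (i) If $\tilde\lambda_{\max}\le\tilde\mu_{\min}$, then $\tilde\sigma(\alpha)<1$ for every $\alpha>0$, and the PLHSS iteration is convergent for every $\alpha>0$. (ii) If $\tilde\lambda_{\max}>\tilde\mu_{\min}$, then $\tilde\sigma(\alpha)<1$ whenever $$\alpha\in\left(0,\frac{2\tilde\lambda_{\max}\tilde\mu_{\min}^{2}}{\tilde\lambda_{\max}^{2}-\tilde\mu_{\min}^{2}}\right),$$ and the PLHSS iteration is convergent for every such $\alpha$.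
   Context: A real symmetric matrix is indefinite if it has at least one positive and at least one negative eigenvalue. For $b\in\mathbb{C}^n$, the PLHSS iteration with preconditioner $V$ and parameter $\alpha>0$ for $Ax=b$ is, from an initial vector $x^{(0)}\in\mathbb{C}^n$ and for $k=0,1,2,\dots$, $$(\alpha V+W)x^{(k+1/2)}=(\alpha V-\mathrm{i}T)x^{(k)}+b,\qquad Tx^{(k+1)}=\mathrm{i}Wx^{(k+1/2)}-\mathrm{i}b.$$ Its iteration matrix is $G(V;\alpha)$. The iteration is called convergent if for all $b$ and $x^{(0)}$ the sequence $x^{(k)}$ converges to the unique solution of $Ax=b$. $\rho$ denotes the spectral radius. The eigenvalues of $V^{-1}W$ and $V^{-1}T$ are real, since these matrices are similar to $V^{-1/2}WV^{-1/2}$ and $V^{-1/2}TV^{-1/2}$. *)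

(* Defs.v *)
From HB Require Import structures.
From mathcomp Require Import all_boot all_order all_algebra.
From mathcomp Require Import complex.
From mathcomp Require Import all_classical all_reals all_analysis.

Set Implicit Arguments.
Unset Strict Implicit.
Unset Printing Implicit Defensive.

Import Order.TTheory GRing.Theory Num.Theory.
Import numFieldNormedType.Exports.

Local Open Scope classical_set_scope.
Local Open Scope ring_scope.
Local Open Scope complex_scope.

Definition posdef_symmx (R : realType) (n : nat) (M : 'M[R]_n) : Prop :=
  M \is symmetricmx /\
  forall x : 'cV[R]_n, x != 0 -> 0 < (x^T *m M *m x) 0 0.

Definition indefinite_symmx (R : realType) (n : nat) (M : 'M[R]_n) : Prop :=
  [/\ M \is symmetricmx,
      exists2 a : R, eigenvalue M a & 0 < a
    & exists2 a : R, eigenvalue M a & a < 0].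

(* The two predicates below range over the real eigenvalues. They are used on
   V^-1 W and V^-1 T with V symmetric positive definite and W, T symmetric, and
   such matrices have no other eigenvalues, being similar to
   V^(-1/2) W V^(-1/2) and V^(-1/2) T V^(-1/2). *)
Definition is_max_eigenvalue (R : realType) (n : nat) (M : 'M[R]_n) (l : R)
    : Prop :=
  eigenvalue M l /\ forall a : R, eigenvalue M a -> a <= l.

Definition is_min_abs_eigenvalue (R : realType) (n : nat) (M : 'M[R]_n) (m : R)
    : Prop :=
  (exists2 a : R, eigenvalue M a & `|a| = m) /\
  forall a : R, eigenvalue M a -> m <= `|a|.

(* The set is finite, and nonempty for n > 0, so the supremum is a maximum. *)
Definition spectral_radius (R : realType) (n : nat) (M : 'M[R[i]]_n) : R :=
  sup [set ComplexField.Normc.normc a | a in [set a : R[i] | eigenvalue M a]].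

Definition cplxmx (R : realType) (m n : nat) (M : 'M[R]_(m, n)) :
  'M[R[i]]_(m, n) := map_mx (real_complex R) M.

Section PLHSS.
Variables (R : realType) (n : nat).
Implicit Types (W T V : 'M[R]_n) (alpha : R) (b : 'cV[R[i]]_n).

Definition plhss_system W T : 'M[R[i]]_n := cplxmx W + 'i%C *: cplxmx T.

Definition plhss_matrix W T V alpha : 'M[R[i]]_n :=
  'i%C *: (invmx (cplxmx T) *m cplxmx W
           *m invmx (alpha%:C *: cplxmx V + cplxmx W)
           *m (alpha%:C *: cplxmx V - 'i%C *: cplxmx T)).

(* The intermediate vector y is the half-step iterate x^(k+1/2). *)
Definition plhss_step W T V alpha b (x x' : 'cV[R[i]]_n) : Prop :=
  exists y : 'cV[R[i]]_n,
    (alpha%:C *: cplxmx V + cplxmx W) *m y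
      = (alpha%:C *: cplxmx V - 'i%C *: cplxmx T) *m x + b
    /\ cplxmx T *m x' = 'i%C *: (cplxmx W *m y) - 'i%C *: b.

Definition plhss_iterates W T V alpha b (x0 : 'cV[R[i]]_n)
    (x : nat -> 'cV[R[i]]_n) : Prop :=
  x 0%N = x0 /\ forall k, plhss_step W T V alpha b (x k) (x k.+1).

(* Since the steps are given by linear systems, the existence of the iterates
   is required explicitly; otherwise the limit condition could hold vacuously.
   The cast to numFieldType selects the topology given by the modulus. *)
Definition plhss_convergent W T V alpha : Prop :=
  forall b : 'cV[R[i]]_n,
    exists2 z : 'cV[R[i]]_n,
      unique (fun z => plhss_system W T *m z = b) z
    & forall x0 : 'cV[R[i]]_n,
        (exists x, plhss_iterates W T V alpha b x0 x) /\
        (forall x, plhss_iterates W T V alpha b x0 x ->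
           x @ \oo --> (z : 'cV[(R[i] : numFieldType)]_n)).

End PLHSS.

Definition plhss_sigma (R : realType) (lmax mumin alpha : R) : R :=
  lmax / (alpha + lmax) * (Num.sqrt (alpha ^+ 2 + mumin ^+ 2) / mumin).

(* Main.v *)
(** Write V = X^* X = Y^* Y with W = X^* D X and T = Y^* M Y, where the real
    diagonal matrices D and M carry the eigenvalues of V^-1 W and V^-1 T: two
    simultaneous diagonalisations, available over R[i] from the spectral theorem.
    Measure an error e by |K e|^2 with K = (alpha - i M) Y.  The first half-step
    reads X^* (alpha + D) X y = Y^* K e and the second Y^* M Y e' = i X^* D X y.
    Here y is the half-step error.  As X and Y define the same norm, these give |(alpha + D) X y| = |K e| and
    |M Y e'| = |D X y|, and entrywise comparison of diagonal matrices yields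
    |K e'| <= sigma |K e|.  Applied to an eigenvector this bounds the spectral
    radius; for sigma < 1 it gives both the invertibility of A, whose kernel
    consists of fixed errors, and geometric convergence. *)
Require Import Defs.
From HB Require Import structures.
From mathcomp Require Import all_boot all_order all_algebra.
From mathcomp Require Import complex.
From mathcomp Require Import all_classical all_reals all_analysis.
From mathcomp Require Import lra.
Set Implicit Arguments.
Unset Strict Implicit.
Unset Printing Implicit Defensive.
Import Order.TTheory GRing.Theory Num.Theory.
Local Open Scope ring_scope.
Local Open Scope sesquilinear_scope.
Local Open Scope complex_scope.

(** * Units and eigenvalues of matrices over a field *)

Lemma mulmx_unit_inj (F : fieldType) m n (A : 'M[F]_m) : A \in unitmx ->
  injective (mulmx A : 'M[F]_(m, n) -> 'M[F]_(m, n)).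
Proof. by move=> Au B C /(congr1 (mulmx (invmx A))); rewrite !mulKmx. Qed.

Lemma diag_mx_unit (F : fieldType) n (d : 'rV[F]_n) :
  (forall j, d 0 j != 0) -> diag_mx d \in unitmx.
Proof. by move=> d0; rewrite unitmxE det_diag unitfE; apply/prodf_neq0. Qed.

(** [eigenvalue] refers to row vectors: row [j] of [P] is a left eigenvector, nonzero since [P] is
    invertible. *)
Lemma eigenvalue_diag_conj (F : fieldType) n (P A : 'M[F]_n) (d : 'rV[F]_n) j :
  P \in unitmx -> P *m A = diag_mx d *m P -> eigenvalue A (d 0 j).
Proof.
move=> Pu PA; apply/eigenvalueP; exists (row j P).
  by rewrite -row_mul PA; apply/rowP => k; rewrite mul_diag_mx !mxE.
apply/eqP => /(congr1 (mulmx^~ (invmx P))).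
rewrite -row_mul mulmxV// mul0mx => /rowP/(_ j); rewrite !mxE eqxx.
by move/eqP; rewrite oner_eq0.
Qed.

(** Both matrices have the same characteristic polynomial. This gives right eigenvectors, on which
    the iteration acts. *)
Lemma eigenvalue_trmx (F : fieldType) n (A : 'M[F]_n) a :
  eigenvalue A^T a = eigenvalue A a.
Proof.
rewrite !eigenvalue_root_char /char_poly.
by rewrite -det_tr /char_poly_mx linearB /= tr_scalar_mx map_trmx trmxK.
Qed.

Lemma eigenvalue_col (F : fieldType) n (A : 'M[F]_n) a : eigenvalue A a ->
  exists2 v : 'cV[F]_n, A *m v = a *: v & v != 0.
Proof.
rewrite -eigenvalue_trmx => /eigenvalueP[v vA v0]; exists v^T.
  by apply: trmx_inj; rewrite trmx_mul trmxK vA linearZ/= trmxK.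
by rewrite -trmx0 (inj_eq trmx_inj).
Qed.

Lemma eigenvalue_unit_neq0 (F : fieldType) n (A : 'M[F]_n) a : A \in unitmx ->
  eigenvalue A a -> a != 0.
Proof.
move=> Au /eigenvalue_col[v vA]; apply: contra_neq => a0.
by apply: (mulmx_unit_inj Au); rewrite vA a0 scale0r mulmx0.
Qed.

(** * Positive definite matrices *)

Section PositiveDefinite.
Variables (R : realType) (n : nat).
Implicit Types (V W : 'M[R]_n) (a : R).

Lemma posdef_symmx_rV V (u : 'rV[R]_n) : posdef_symmx V -> u != 0 ->
  0 < (u *m V *m u^T) 0 0.
Proof.
move=> [_ Vpos] u0; rewrite -{1}[u]trmxK; apply: Vpos.
by rewrite -trmx0 (inj_eq trmx_inj).
Qed.

Lemma posdef_symmx1 : posdef_symmx (1%:M : 'M[R]_n).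
Proof.
split=> [|x x0]; first by apply/is_hermitianmxP; rewrite scale1r trmx1 map_mx1.
rewrite mulmx1 mxE lt_neqAle eq_sym; apply/andP; split; last first.
  by apply: sumr_ge0 => i _; rewrite mxE -expr2 sqr_ge0.
apply: contra_neq x0 => x0; apply/colP => i; apply/eqP; rewrite !mxE -sqrf_eq0.
move/psumr_eq0P : x0 => /(_ _ i isT); rewrite mxE -expr2 => -> // j _.
by rewrite mxE -expr2 sqr_ge0.
Qed.

Lemma posdef_symmx_unit V : posdef_symmx V -> V \in unitmx.
Proof.
move=> Vpos; rewrite -row_free_unit -kermx_eq0.
apply/rowV0P => u /sub_kermxP uV.
apply/eqP/negPn/negP => /(posdef_symmx_rV Vpos).
by rewrite uV mul0mx mxE ltxx.
Qed.

(** With [u = v V^-1] the eigenvalue equation becomes [u W = a u V], so [a] is a quotient of two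
    positive quadratic forms. *)
Lemma eigenvalue_posdef_gt0 V W a : posdef_symmx V -> posdef_symmx W ->
  eigenvalue (invmx V *m W) a -> 0 < a.
Proof.
move=> Vpos Wpos /eigenvalueP[v vE v0]; have Vu := posdef_symmx_unit Vpos.
pose u := v *m invmx V.
have u0 : u != 0.
  by apply: contra_neq v0 => u0; rewrite -[v](mulmxKV Vu) -/u u0 mul0mx.
have uW : u *m W = a *: (u *m V) by rewrite /u mulmxKV// -mulmxA.
have := posdef_symmx_rV Wpos u0; rewrite uW -scalemxAl mxE.
by rewrite pmulr_lgt0// posdef_symmx_rV.
Qed.

End PositiveDefinite.

(** * Hermitian spectral theorem and simultaneous diagonalisation *)

Section Congruence.
Variables (R : realType) (n : nat).
Implicit Types (V A : 'M[R]_n).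
Local Notation C := R[i].

Lemma trmxC_mul m p q (A : 'M[C]_(m, p)) (B : 'M[C]_(p, q)) :
  (A *m B)^t* = B^t* *m A^t*.
Proof. by rewrite trmx_mul map_mxM. Qed.

Lemma conjC_real_complex (a : R) : Num.conj (a%:C) = a%:C.
Proof. by rewrite conj_Creal// complex_real eqxx. Qed.

Lemma trmxC_cplxmx m (A : 'M[R]_(m, n)) : (cplxmx A)^t* = cplxmx A^T.
Proof. by apply/matrixP => i j; rewrite !mxE; exact: conjC_real_complex. Qed.

Lemma trmxC_unit (A : 'M[C]_n) : (A^t* \in unitmx) = (A \in unitmx).
Proof. by rewrite map_unitmx unitmx_tr. Qed.

Lemma symmx_trmx A : A \is symmetricmx -> A^T = A.
Proof. by move=> /is_hermitianmxP; rewrite scale1r map_mx_id. Qed.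

(** The diagonalisations are complex; a real number that is an eigenvalue over [R[i]] is already one
    over [R]. *)
Lemma eigenvalue_cplxmx_diag_conj (P : 'M[C]_n) A (d : 'rV[R]_n) j :
  P \in unitmx -> P *m cplxmx A = cplxmx (diag_mx d) *m P ->
  eigenvalue A (d 0 j).
Proof.
rewrite /cplxmx map_diag_mx => Pu PA.
by have := eigenvalue_diag_conj j Pu PA; rewrite mxE eigenvalue_map.
Qed.

Lemma hermsymmx_trmxC (A : 'M[C]_n) : (A \is hermsymmx) = (A^t* == A).
Proof. by rewrite qualifE scale1r eq_sym. Qed.

Lemma hermsymmx_spectral (A : 'M[C]_n) : A^t* = A ->
  exists P : 'M[C]_n, exists2 d : 'rV[R]_n,
    P \is unitarymx & A = P^t* *m cplxmx (diag_mx d) *m P.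
Proof.
move=> /eqP; rewrite -hermsymmx_trmxC => Ah.
have /orthomx_spectralP AE := hermitian_normalmx Ah.
have /mxOverP dreal := hermitian_spectral_diag_real Ah.
exists (spectralmx A), (map_mx (@complex.Re R) (spectral_diag A)).
  exact: spectral_unitarymx.
rewrite -invmx_unitary ?spectral_unitarymx// [LHS]AE; congr (_ *m _ *m _).
apply/matrixP => i j; rewrite !mxE rmorphMn/=; congr (_ *+ _).
by rewrite RRe_real.
Qed.

(** From [V = P^* D P] take [L = sqrt D P]; the entries of [D] are positive by
    [eigenvalue_posdef_gt0] for the pair [1], [V]. *)
Lemma posdef_symmx_factor V : posdef_symmx V ->
  exists2 L : 'M[C]_n, L \in unitmx & cplxmx V = L^t* *m L.
Proof.
move=> Vpos; have Vt := symmx_trmx Vpos.1.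
have := trmxC_cplxmx V; rewrite Vt => /hermsymmx_spectral[P [d Pu VE]].
have d_gt0 j : 0 < d 0 j.
  apply: (eigenvalue_posdef_gt0 (posdef_symmx1 R n) Vpos).
  rewrite invmx1 mul1mx.
  apply: eigenvalue_cplxmx_diag_conj (unitarymx_unit Pu) _.
  by rewrite VE !mulmxA (unitarymxP Pu) mul1mx.
pose s : 'rV[R]_n := map_mx Num.sqrt d.
exists (cplxmx (diag_mx s) *m P).
  rewrite unitmx_mul (unitarymx_unit Pu) andbT map_unitmx diag_mx_unit// => j.
  by rewrite mxE gt_eqF// sqrtr_gt0.
have dE : cplxmx (diag_mx d) = cplxmx (diag_mx s) *m cplxmx (diag_mx s).
  rewrite -map_mxM mulmx_diag; congr (map_mx _ (diag_mx _)).
  by apply/rowP => j; rewrite !mxE -expr2 sqr_sqrtr// ltW.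
by rewrite trmxC_mul trmxC_cplxmx tr_diag_mx VE dE !mulmxA.
Qed.

(** Given [V = L^* L], the matrix [B = L^-* A L^-1] is Hermitian, say [B = P^* D P]. Then [X = P L]
    serves both [V] and [A], because [P] is unitary. *)
Lemma posdef_pencil_diag V A : posdef_symmx V -> A \is symmetricmx ->
  exists X : 'M[C]_n, exists2 d : 'rV[R]_n,
    [/\ X \in unitmx, cplxmx V = X^t* *m X
      & cplxmx A = X^t* *m cplxmx (diag_mx d) *m X]
    & forall j, eigenvalue (invmx V *m A) (d 0 j).
Proof.
move=> /posdef_symmx_factor[L Lu VE] /symmx_trmx At.
have Ltu : L^t* \in unitmx by rewrite trmxC_unit.
pose B := invmx (L^t*) *m cplxmx A *m invmx L.
have Bt : B^t* = B.
  rewrite /B !trmxC_mul trmxC_cplxmx At mulmxA; congr (_ *m _ *m _).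
    by rewrite trmx_inv map_invmx.
  by rewrite -map_invmx -trmx_inv trmxCK.
have [P [d Pu BE]] := hermsymmx_spectral Bt.
pose X := P *m L.
have Xu : X \in unitmx by rewrite unitmx_mul (unitarymx_unit Pu).
have Xt : X^t* = L^t* *m P^t* by exact: trmxC_mul.
have PtP : P^t* *m P = 1%:M.
  by move: Pu; rewrite -trmxC_unitary => /unitarymxP; rewrite trmxCK.
have XE : cplxmx V = X^t* *m X.
  by rewrite Xt VE -mulmxA; congr (_ *m _); rewrite mulmxA PtP mul1mx.
have AE : cplxmx A = X^t* *m cplxmx (diag_mx d) *m X.
  rewrite Xt /X mulmxA -2!(mulmxA (L^t*)) -BE /B.
  by rewrite -(mulmxA (invmx _)) (mulKVmx Ltu) (mulmxKV Lu).
move: X Xu Xt XE AE => X Xu _ XE AE; exists X, d => // j.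
apply: (eigenvalue_cplxmx_diag_conj j Xu).
have Vu : cplxmx V \in unitmx by rewrite VE unitmx_mul Ltu.
(* Multiplied by [X^*], the claim [X V^-1 A = D X] reads [V V^-1 A = A]. *)
apply: (mulmx_unit_inj (A := X^t*)); first by rewrite trmxC_unit.
rewrite !mulmxA -XE -AE /cplxmx -map_mxM; congr map_mx.
by rewrite mulKVmx// -(map_unitmx (real_complex R)).
Qed.

End Congruence.

(** * Matrix regrouping and the scalar bounds behind [plhss_sigma] *)

Lemma mulmx_congr_comb (F : comNzRingType) n (A B D : 'M[F]_n) a b :
  a *: (A *m B) + b *: (A *m D *m B) = A *m ((a%:M + b *: D) *m B).
Proof.
by rewrite mulmxDl mulmxDr mul_scalar_mx -!scalemxAl -!scalemxAr mulmxA.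
Qed.

(* Stated over an abstract ring: rewriting with mulmxA at R[i] unfolds the
   complex structures and is prohibitively slow. *)
Lemma mulmx_regroup (F : comNzRingType) n (A B D : 'M[F]_n) (x : 'cV[F]_n) :
  (A *m (D *m B) *m x = A *m (D *m (B *m x))) *
  (A *m D *m B *m x = A *m (D *m (B *m x))).
Proof. by rewrite !mulmxA. Qed.

(** The ratio [(a^2 + m^2) / m^2] does not increase with [|m|], so [mu] is the worst case. *)
Lemma sqr_add_ratio_le (F : realFieldType) (a m mu : F) :
  0 < mu -> mu <= `|m| ->
  a ^+ 2 + m ^+ 2 <= (a ^+ 2 + mu ^+ 2) / mu ^+ 2 * m ^+ 2.
Proof.
move=> mu0 mu_le; rewrite mulrAC ler_pdivlMr ?exprn_gt0//.
have : mu ^+ 2 <= m ^+ 2.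
  by rewrite -(real_normK (num_real m)) ler_pXn2r ?nnegrE// ltW.
by have := sqr_ge0 a; nra.
Qed.

(** The ratio [d / (a + d)] increases with [d], so [l] is the worst case. *)
Lemma sqr_ratio_le (F : realFieldType) (a d l : F) : 0 < a -> 0 < d -> d <= l ->
  d ^+ 2 <= (l / (a + l)) ^+ 2 * (a + d) ^+ 2.
Proof.
move=> a0 d0 dl; have l0 := lt_le_trans d0 dl.
have le_d : d <= l / (a + l) * (a + d).
  by rewrite mulrAC ler_pdivlMr ?addr_gt0//; nra.
by rewrite -exprMn ler_pXn2r// nnegrE; lra.
Qed.

(** * The squared Euclidean norm on complex columns *)

Section SquaredNorm.
Variables (R : realType) (n : nat).
Implicit Types (x : 'cV[R[i]]_n) (a b : 'rV[R[i]]_n) (c : R).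
Local Notation normc := ComplexField.Normc.normc.

Lemma normc_ge0 (z : R[i]) : 0 <= normc z.
Proof. by case: z => u v; exact: sqrtr_ge0. Qed.

Definition sqnorm x : R := \sum_i normc (x i 0) ^+ 2.

Lemma sqnormE x : (sqnorm x)%:C = (x^t* *m x) 0 0.
Proof.
rewrite mxE rmorph_sum/=; apply: eq_bigr => i _.
by rewrite !mxE mulrC -normCK rmorphXn.
Qed.

Lemma sqnorm_ge0 x : 0 <= sqnorm x.
Proof. by apply: sumr_ge0 => i _; rewrite sqr_ge0. Qed.

Lemma normc_le_sqnorm x i : normc (x i 0) ^+ 2 <= sqnorm x.
Proof.
by rewrite /sqnorm (bigD1 i)//= lerDl; apply: sumr_ge0 => j _; rewrite sqr_ge0.
Qed.

Lemma sqnorm_eq0 x : sqnorm x = 0 -> x = 0.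
Proof.
move=> x0; apply/colP => i; rewrite mxE; apply: ComplexField.Normc.eq0_normc.
apply/eqP; rewrite -sqrf_eq0 eq_le sqr_ge0 andbT -x0.
exact: normc_le_sqnorm.
Qed.

Lemma sqnormZ (z : R[i]) x : sqnorm (z *: x) = normc z ^+ 2 * sqnorm x.
Proof.
rewrite /sqnorm mulr_sumr; apply: eq_bigr => i _.
by rewrite mxE ComplexField.Normc.normcM exprMn.
Qed.

(** Write [x = X u] and [y = Y v]. The last hypothesis becomes [X^* X u = X^* X v], so [u = v], and
    both norms equal [u^* X^* X u]. *)
Lemma sqnorm_congr (X Y : 'M[R[i]]_n) (x y : 'cV[R[i]]_n) :
  X \in unitmx -> Y \in unitmx -> X^t* *m X = Y^t* *m Y ->
  X^t* *m x = Y^t* *m y -> sqnorm x = sqnorm y.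
Proof.
move=> Xu Yu XY; rewrite -[x](mulKVmx Xu) -[y](mulKVmx Yu).
move: (invmx X *m x) (invmx Y *m y) => u v.
have XXu : X^t* *m X \in unitmx by rewrite unitmx_mul trmxC_unit Xu.
have sq (Z : 'M[R[i]]_n) (w : 'cV[R[i]]_n) :
    (sqnorm (Z *m w))%:C = (w^t* *m (Z^t* *m Z *m w)) 0 0.
  by rewrite sqnormE trmxC_mul -mulmxA [Z^t* *m (Z *m w)]mulmxA.
rewrite [X^t* *m _]mulmxA [Y^t* *m _]mulmxA -XY => /(mulmx_unit_inj XXu) ->.
by apply: (@complexI R); rewrite !sq XY.
Qed.

Lemma sqnorm_diag_le a b c x :
  (forall j, normc (a 0 j) ^+ 2 <= c * normc (b 0 j) ^+ 2) ->
  sqnorm (diag_mx a *m x) <= c * sqnorm (diag_mx b *m x).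
Proof.
move=> ab; rewrite /sqnorm mulr_sumr; apply: ler_sum => j _.
rewrite !mul_diag_mx !mxE !ComplexField.Normc.normcM !exprMn [leRHS]mulrA.
by rewrite ler_wpM2r// sqr_ge0.
Qed.

End SquaredNorm.

(** * Contraction of the error in one full step *)

Section HalfSteps.
Variables (R : realType) (n : nat) (W T V : 'M[R]_n) (alpha lmax mumin : R).
Hypotheses (W_posdef : posdef_symmx W) (T_sym : T \is symmetricmx)
  (T_unit : T \in unitmx) (V_posdef : posdef_symmx V) (alpha_gt0 : 0 < alpha)
  (lmaxP : is_max_eigenvalue (invmx V *m W) lmax)
  (muminP : is_min_abs_eigenvalue (invmx V *m T) mumin).
Local Notation normc := ComplexField.Normc.normc.
Local Notation C := R[i].

Lemma lmax_gt0 : 0 < lmax.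
Proof. by case: lmaxP => /(eigenvalue_posdef_gt0 V_posdef W_posdef). Qed.

Lemma mumin_gt0 : 0 < mumin.
Proof.
case: muminP => [[a aT <-] _]; rewrite normr_gt0.
apply: eigenvalue_unit_neq0 aT.
by rewrite unitmx_mul unitmx_inv posdef_symmx_unit.
Qed.

Lemma plhss_sigma_ge0 : 0 <= plhss_sigma lmax mumin alpha.
Proof.
have l0 := lmax_gt0; have m0 := mumin_gt0.
by rewrite /plhss_sigma !(mulr_ge0, invr_ge0, addr_ge0, sqrtr_ge0)// ltW.
Qed.

Lemma plhss_sigma_sqr : plhss_sigma lmax mumin alpha ^+ 2
  = (alpha ^+ 2 + mumin ^+ 2) / mumin ^+ 2 * (lmax / (alpha + lmax)) ^+ 2.
Proof.
rewrite /plhss_sigma !exprMn !exprVn sqr_sqrtr ?addr_ge0 ?sqr_ge0//.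
by rewrite mulrC.
Qed.

Lemma plhss_contraction : exists2 K : 'M[C]_n, K \in unitmx &
  forall e e', plhss_step W T V alpha 0 e e' ->
    sqnorm (K *m e') <= plhss_sigma lmax mumin alpha ^+ 2 * sqnorm (K *m e).
Proof.
have l0 := lmax_gt0; have m0 := mumin_gt0.
have [X [d [Xu VX WE] dW]] := posdef_pencil_diag V_posdef W_posdef.1.
have [Y [m [Yu VY TE] mT]] := posdef_pencil_diag V_posdef T_sym.
have d_gt0 j : 0 < d 0 j by exact: eigenvalue_posdef_gt0 (dW j).
have d_le j : d 0 j <= lmax by exact: lmaxP.2.
have m_ge j : mumin <= `|m 0 j| by exact: muminP.2.
(* [k] and [g] are the diagonals of [alpha - i M] and [alpha + D], to which the two matrices of the
   first half-step reduce. *)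
pose k : 'rV[C]_n := \row_j (alpha%:C - 'i%C * (m 0 j)%:C).
pose g : 'rV[C]_n := \row_j (alpha%:C + (d 0 j)%:C).
have k_sqr j : normc (k 0 j) ^+ 2 = alpha ^+ 2 + m 0 j ^+ 2.
  rewrite mxE /=; simpc; rewrite /= sqr_sqrtr ?addr_ge0 ?sqr_ge0//.
  by rewrite sqrrN.
have kE : diag_mx k = alpha%:C%:M - 'i%C *: cplxmx (diag_mx m).
  by apply/matrixP => i j; rewrite !mxE; case: (i == j);
    rewrite ?mulr1n ?mulr0n ?mulr1 ?rmorph0 ?mulr0 ?subr0.
have gE : diag_mx g = alpha%:C%:M + cplxmx (diag_mx d).
  by apply/matrixP => i j; rewrite !mxE; case: (i == j);
    rewrite ?mulr1n ?mulr0n ?mulr1 ?rmorph0 ?mulr0 ?addr0.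
have AE : alpha%:C *: cplxmx V - 'i%C *: cplxmx T = Y^t* *m (diag_mx k *m Y).
  by rewrite VY TE -scaleNr mulmx_congr_comb kE scaleNr.
have BE : alpha%:C *: cplxmx V + cplxmx W = X^t* *m (diag_mx g *m X).
  by rewrite VX WE -[X^t* *m _ *m X]scale1r mulmx_congr_comb gE scale1r.
have isom := sqnorm_congr Xu Yu (etrans (esym VX) VY).
exists (diag_mx k *m Y).
  rewrite unitmx_mul Yu andbT diag_mx_unit// => j.
  apply/eqP => k0; have := k_sqr j; rewrite k0 ComplexField.Normc.normc0 expr0n.
  have := sqr_ge0 (m 0 j); have := exprn_gt0 2 alpha_gt0; rewrite /=; lra.
move=> e e' [y []]; rewrite AE BE addr0 scaler0 subr0 TE WE.
(* Each half-step equates an [X^*] image with a [Y^*] image, so [isom] turns it into an equality of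
   norms; the factor [i] has modulus one. *)
rewrite !mulmx_regroup scalemxAr => /isom gy /esym/isom.
rewrite sqnormZ /= expr0n expr1n add0r sqrtr1 expr1n mul1r => me'.
rewrite plhss_sigma_sqr -mulrA; move: gy me'.
rewrite -2!(mulmxA (diag_mx k)) /cplxmx !map_diag_mx => <- me'.
(* [c] is the squared second factor of [plhss_sigma]; it bounds [|K e'|^2] by
   [|M Y e'|^2 = |D X y|^2]. *)
pose c := (alpha ^+ 2 + mumin ^+ 2) / mumin ^+ 2.
have : sqnorm (diag_mx k *m (Y *m e')) <=
    c * sqnorm (diag_mx (map_mx (real_complex R) m) *m (Y *m e')).
  apply: sqnorm_diag_le => j; rewrite k_sqr mxE /=.
  by rewrite expr0n addr0 sqr_sqrtr ?sqr_ge0// sqr_add_ratio_le.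
move/le_trans; apply; rewrite -me' ler_wpM2l//.
  by rewrite divr_ge0 ?addr_ge0 ?sqr_ge0.
(* The first factor compares [|D X y|] with [|(alpha + D) X y| = |K e|]. *)
apply: sqnorm_diag_le => j; rewrite !mxE /=; simpc.
by rewrite /= expr0n !addr0 !sqr_sqrtr ?sqr_ge0// sqr_ratio_le.
Qed.

End HalfSteps.

(** * Algebra of the splitting, with [V] standing for [alpha V] *)

Section Splitting.
Variables (F : fieldType) (n : nat) (i : F) (V W T : 'M[F]_n).
Hypothesis ii : i * i = -1.
Implicit Types b e x z : 'cV[F]_n.

(** The matrix [W + i T] is the difference of [V + W] and [V - i T]. A solution thus passes
    unchanged through both half-steps, with itself as half-step iterate. *)
Lemma splitting_fixpoint b z : (W + i *: T) *m z = b ->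
  (V + W) *m z = (V - i *: T) *m z + b /\ T *m z = i *: (W *m z) - i *: b.
Proof.
move=> <-; split; first by rewrite -mulmxDl addrACA [- _ + _]addrC subrr addr0.
rewrite mulmxDl scalerDr opprD addrA subrr add0r -scalemxAl scalerA ii.
by rewrite scaleN1r opprK.
Qed.

(** Applying [T] cancels [T^-1] and leaves the second half-step for [b = 0], leading from [e] to
    [a e]. *)
Lemma splitting_eigenvector (a : F) e : T \in unitmx ->
  i *: (invmx T *m W *m invmx (V + W) *m (V - i *: T)) *m e = a *: e ->
  T *m (a *: e) = i *: (W *m (invmx (V + W) *m ((V - i *: T) *m e))).
Proof.
by move=> Tu <-; rewrite -scalemxAl -scalemxAr -!mulmxA (mulKVmx Tu).
Qed.

End Splitting.

Lemma mulmx_affine_sub (F : comNzRingType) n (A B : 'M[F]_n)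
    (x y z b : 'cV[F]_n) :
  B *m y = A *m x + b -> B *m z = A *m z + b -> B *m (y - z) = A *m (x - z).
Proof. by rewrite !mulmxBr => -> ->; rewrite opprD addrACA subrr addr0. Qed.

Lemma unitmx_col_ker (F : fieldType) n (A : 'M[F]_n) :
  (forall u : 'cV[F]_n, A *m u = 0 -> u = 0) -> A \in unitmx.
Proof.
move=> A0; rewrite -unitmx_tr -row_free_unit -kermx_eq0.
apply/rowV0P => u /sub_kermxP uA; apply: trmx_inj; rewrite trmx0; apply: A0.
by apply: trmx_inj; rewrite trmx_mul trmxK uA trmx0.
Qed.

Lemma posdef_symmx_comb (R : realType) n (V W : 'M[R]_n) (a : R) : 0 < a ->
  posdef_symmx V -> posdef_symmx W -> posdef_symmx (a *: V + W).
Proof.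
move=> a0 [Vs Vp] [Ws Wp]; split.
  apply/is_hermitianmxP; rewrite scale1r map_mx_id//.
  by rewrite linearD linearZ/= !symmx_trmx.
move=> x x0; rewrite mulmxDr mulmxDl -scalemxAr -scalemxAl !mxE addr_gt0//.
  by rewrite mulr_gt0//; have := Vp x x0; rewrite mxE.
by have := Wp x x0; rewrite mxE.
Qed.

(** * Geometric convergence in a weighted norm *)

Section LinearConvergence.
Import numFieldNormedType.Exports.
Variables (R : realType) (n : nat).
Local Notation normc := ComplexField.Normc.normc.
Local Notation C := R[i].

Lemma normc_sum (I : finType) (f : I -> C) :
  normc (\sum_i f i) <= \sum_i normc (f i).
Proof.
elim/big_ind2: _ => [|x1 x2 y1 y2 le1 le2|//].
  by rewrite ComplexField.Normc.normc0.
by rewrite (le_trans (le_normcD _ _))// lerD.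
Qed.

Lemma normc_mulmx_le (A : 'M[C]_n) (v : 'cV[C]_n) i :
  normc ((A *m v) i 0) <= (\sum_k \sum_j normc (A k j)) * Num.sqrt (sqnorm v).
Proof.
have row_le : \sum_j normc (A i j) <= \sum_k \sum_j normc (A k j).
  rewrite [leRHS](bigD1 i)//= lerDl; apply: sumr_ge0 => k _.
  by apply: sumr_ge0 => j _; exact: normc_ge0.
apply: le_trans (ler_wpM2r (sqrtr_ge0 _) row_le).
rewrite mxE mulr_suml (le_trans (normc_sum _))//; apply: ler_sum => j _.
rewrite ComplexField.Normc.normcM ler_wpM2l ?normc_ge0//.
by rewrite -(ger0_norm (normc_ge0 (v j 0))) -sqrtr_sqr ler_wsqrtr//
  normc_le_sqnorm.
Qed.

(** By induction [|K (x_k - z)| <= q^k |K (x_0 - z)|]; applying [K^-1] bounds every entry of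
    [x_k - z] by a geometric sequence. *)
Lemma contraction_cvg (K : 'M[C]_n) (q : R) (x : nat -> 'cV[C]_n)
    (z : 'cV[C]_n) : K \in unitmx -> 0 <= q < 1 ->
  (forall k, sqnorm (K *m (x k.+1 - z)) <= q ^+ 2 * sqnorm (K *m (x k - z))) ->
  (x @ \oo --> (z : 'cV[(C : numFieldType)]_n))%classic.
Proof.
move=> Ku /andP[q0 q1] xq.
pose c := \sum_k \sum_j normc (invmx K k j).
pose s := Num.sqrt (sqnorm (K *m (x 0 - z))).
have bound k i : normc ((x k - z) i 0) <= c * (s * q ^+ k).
  rewrite -[x k - z](mulKmx Ku) (le_trans (normc_mulmx_le _ _ _))//.
  rewrite ler_wpM2l//.
    by do 2![apply: sumr_ge0 => ? _]; exact: normc_ge0.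
  elim: k => [|k IHk]; first by rewrite expr0 mulr1.
  rewrite (le_trans (ler_wsqrtr (xq k)))// sqrtrM ?sqr_ge0// sqrtr_sqr.
  by rewrite ger0_norm// exprS mulrCA ler_wpM2l.
have cs0 : ((fun k => c * (s * q ^+ k)) @ \oo --> (0 : R))%classic.
  have -> : (fun k => c * (s * q ^+ k)) = geometric (c * s) q.
    by apply/funext => k; rewrite /= mulrA.
  by apply: cvg_geometric; rewrite ger0_norm.
apply/(@cvg_ballP (C : numFieldType) 'M[(C : numFieldType)]_(n, 1)).
(* Radii of balls lie in [R[i]]; a positive one has zero imaginary part, so it is a real [e]. *)
move=> -[e e'] /[dup] eps0; rewrite ltcE/= => /andP[/eqP e'0 e0].
have near_lt : (\forall k \near \oo, c * (s * q ^+ k) < e)%classic.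
  exact: cvgr_lt cs0 _ e0.
apply: filterS near_lt => k xk; split => // i j.
rewrite (ord1 j) -ball_normE/= distrC.
have -> : e +i* e' = e%:C by rewrite e'0.
have := le_lt_trans (bound k i) xk; rewrite -ltcR !mxE; exact.
Qed.

End LinearConvergence.

(** * From contraction to the spectral radius and convergence *)

Section Consequences.
Variables (R : realType) (n : nat) (W T V : 'M[R]_n) (alpha q : R).
Variable K : 'M[R[i]]_n.
Hypotheses (V_posdef : posdef_symmx V) (W_posdef : posdef_symmx W)
  (T_unit : T \in unitmx) (alpha_gt0 : 0 < alpha) (K_unit : K \in unitmx)
  (q_ge0 : 0 <= q)
  (contr : forall e e', plhss_step W T V alpha 0 e e' ->
     sqnorm (K *m e') <= q ^+ 2 * sqnorm (K *m e)).

Lemma mul_ii : 'i%C * 'i%C = -1 :> R[i].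
Proof. by rewrite -expr2 sqr_i. Qed.

Lemma plhss_half_step_unit :
  alpha%:C *: cplxmx V + cplxmx W \in unitmx.
Proof.
have -> : alpha%:C *: cplxmx V + cplxmx W = cplxmx (alpha *: V + W).
  by rewrite /cplxmx map_mxD map_mxZ.
by rewrite map_unitmx; apply: posdef_symmx_unit; exact: posdef_symmx_comb.
Qed.

Lemma plhss_step_sub b x x' z : plhss_system W T *m z = b ->
  plhss_step W T V alpha b x x' -> plhss_step W T V alpha 0 (x - z) (x' - z).
Proof.
move=> /(splitting_fixpoint (alpha%:C *: cplxmx V) mul_ii)[z1 z2].
(* The half-step error is [y - z], as [z] is its own half-step iterate. *)
move=> [y [y1 y2]]; exists (y - z); split.
  by rewrite addr0; exact: mulmx_affine_sub y1 z1.
by rewrite scaler0 subr0 !mulmxBr y2 z2 scalerBr opprB addrA subrK.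
Qed.

Lemma spectral_radius_le : spectral_radius (plhss_matrix W T V alpha) <= q.
Proof.
rewrite /spectral_radius; set S := [set _ | _ in _]%classic.
(* Without eigenvalues the supremum takes its default value 0, and [q] is nonnegative. *)
have [->|/set0P S0] := eqVneq S set0; first by rewrite sup0.
apply: ge_sup => // _ [a aG <-].
have [e Ge e0] := eigenvalue_col aG.
have : plhss_step W T V alpha 0 e (a *: e).
  have Tu : cplxmx T \in unitmx by rewrite map_unitmx.
  exists (invmx (alpha%:C *: cplxmx V + cplxmx W)
          *m ((alpha%:C *: cplxmx V - 'i%C *: cplxmx T) *m e)); split.
    by rewrite addr0 (mulKVmx plhss_half_step_unit).
  rewrite scaler0 subr0.
  exact: (splitting_eigenvector Tu Ge).
move/contr; rewrite -scalemxAr sqnormZ.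
have Ke_gt0 : 0 < sqnorm (K *m e).
  rewrite lt_neqAle sqnorm_ge0 andbT eq_sym; apply: contra_neq e0.
  by move=> /sqnorm_eq0 Ke0; apply: (mulmx_unit_inj K_unit); rewrite mulmx0.
by rewrite ler_pM2r// ler_pXn2r ?nnegrE ?normc_ge0.
Qed.

Lemma plhss_convergent_of_contraction : q < 1 -> plhss_convergent W T V alpha.
Proof.
move=> q1 b.
have Au : plhss_system W T \in unitmx.
  apply: unitmx_col_ker => u Au.
  have [u1 u2] := splitting_fixpoint (alpha%:C *: cplxmx V) mul_ii Au.
  (* A kernel vector is its own successor, so [|K u|^2 <= q^2 |K u|^2], which forces [K u = 0]. *)
  have /contr le_u : plhss_step W T V alpha 0 u u by exists u.
  apply: (mulmx_unit_inj K_unit); rewrite mulmx0; apply: sqnorm_eq0.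
  apply/eqP; rewrite eq_le sqnorm_ge0 andbT.
  have := sqnorm_ge0 (K *m u); have : q ^+ 2 < 1 by rewrite expr_lt1.
  by nra.
exists (invmx (plhss_system W T) *m b).
  by split=> [|z' <-]; [rewrite mulKVmx|rewrite mulKmx].
set z := invmx _ *m b => x0.
have Az : plhss_system W T *m z = b by rewrite mulKVmx.
split.
  (* Both left-hand matrices are invertible, so iterates are obtained by solving the two systems in
     turn. *)
  pose B := alpha%:C *: cplxmx V + cplxmx W.
  pose y (x : 'cV_n) :=
    invmx B *m ((alpha%:C *: cplxmx V - 'i%C *: cplxmx T) *m x + b).
  pose next x := invmx (cplxmx T) *m ('i%C *: (cplxmx W *m y x) - 'i%C *: b).
  exists (fun k => iter k next x0); split=> // k.
  exists (y (iter k next x0)); split.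
    by rewrite (mulKVmx plhss_half_step_unit).
  by rewrite iterS mulKVmx// map_unitmx.
move=> x [_ xS]; apply: (contraction_cvg K_unit (q := q)).
  by rewrite q_ge0.
by move=> k; apply: contr; exact: plhss_step_sub (xS k).
Qed.

End Consequences.

(** * The parameter range with [plhss_sigma] below one, and the theorem *)

Lemma plhss_sigma_lt1 (R : realType) (l m a : R) : 0 < l -> 0 < m -> 0 < a ->
  a * (l ^+ 2 - m ^+ 2) < 2 * l * m ^+ 2 -> plhss_sigma l m a < 1.
Proof.
(* Squared and cleared of denominators, the claim is [l^2 (a^2 + m^2) < (a + l)^2 m^2]. Cancelling
   [l^2 m^2] and a factor [a] leaves the hypothesis, which covers both regimes. *)
move=> l0 m0 a0 lt_a; rewrite /plhss_sigma mulf_div ltr_pdivrMr; last first.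
  by rewrite mulr_gt0// addr_gt0.
rewrite mul1r -(ltr_pXn2r (n := 2))// ?nnegrE ?mulr_ge0 ?sqrtr_ge0//; try lra.
rewrite !exprMn sqr_sqrtr ?addr_ge0 ?sqr_ge0//.
by rewrite -(ltr_pM2l a0) in lt_a; lra.
Qed.

Theorem theorem3p1 (R : realType) (n : nat) (W T V : 'M[R]_n)
    (lmax mumin : R)
    (hW : posdef_symmx W)
    (hT : indefinite_symmx T)
    (hTns : T \in unitmx)
    (hV : posdef_symmx V)
    (hlmax : is_max_eigenvalue (invmx V *m W) lmax)
    (hmumin : is_min_abs_eigenvalue (invmx V *m T) mumin) :
  [/\ 0 < mumin,
      forall alpha : R, 0 < alpha ->
        spectral_radius (plhss_matrix W T V alpha)
          <= plhss_sigma lmax mumin alpha,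
      lmax <= mumin ->
        forall alpha : R, 0 < alpha ->
          plhss_sigma lmax mumin alpha < 1 /\ plhss_convergent W T V alpha
    & mumin < lmax ->
        forall alpha : R,
          0 < alpha < 2 * lmax * mumin ^+ 2 / (lmax ^+ 2 - mumin ^+ 2) ->
          plhss_sigma lmax mumin alpha < 1 /\ plhss_convergent W T V alpha].
Proof.
have [T_sym _ _] := hT.
have m0 := mumin_gt0 hTns hV hmumin.
have l0 := lmax_gt0 hW hV hlmax.
have sigma_ge0 alpha : 0 < alpha -> 0 <= plhss_sigma lmax mumin alpha.
  by move=> a0; exact: plhss_sigma_ge0 hW hTns hV a0 hlmax hmumin.
have conv alpha : 0 < alpha -> plhss_sigma lmax mumin alpha < 1 ->
    plhss_convergent W T V alpha.
  move=> a0.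
  have [K Ku contr] := plhss_contraction hW T_sym hTns hV a0 hlmax hmumin.
  exact: plhss_convergent_of_contraction (sigma_ge0 _ a0) contr.
split=> // [alpha a0|le_lm alpha a0|lt_ml alpha /andP[a0 lt_a]].
- have [K Ku contr] := plhss_contraction hW T_sym hTns hV a0 hlmax hmumin.
  exact: spectral_radius_le hV hW hTns a0 Ku (sigma_ge0 _ a0) contr.
- have s1 : plhss_sigma lmax mumin alpha < 1.
    (* Here [lmax^2 - mumin^2 <= 0], so the condition holds for every positive [alpha]. *)
    apply: plhss_sigma_lt1 => //; apply: (@le_lt_trans _ _ 0); last first.
      by rewrite !mulr_gt0.
    by rewrite pmulr_rle0// subr_le0 ler_pXn2r// nnegrE ltW.
  by split; [|exact: conv].
- have s1 : plhss_sigma lmax mumin alpha < 1.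
    apply: plhss_sigma_lt1 => //; rewrite -ltr_pdivlMr// subr_gt0.
    by rewrite ltr_pXn2r// nnegrE ltW.
  by split; [|exact: conv].
Qed.
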